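(* Let $(\Omega,\mathcal{F})$ be a measurable space, let $\mathcal{P}$ be the set of all probability measures on $(\Omega,\mathcal{F})$, let $q\in\mathcal{P}$, let $\mathcal{P}_q=\{p\in\mathcal{P}\mid p\ll q\}$, let $H$ be an affine set of signed measures on $(\Omega,\mathcal{F})$ with finite variation, and let $$\mathcal{M}:=\{p\in\mathcal{P}_q\cap H\mid p\approx q\}.$$ Then, every extreme point of $\mathcal{M}$ is an extreme point of $\mathcal{P}_q\cap H$.
   Context: We write $p\ll q$ for absolute continuity, and $p\approx q$ if $p\ll q$ and $q\ll p$. An affine set $H$ is a subset of the vector space of signed measures of finite variation that contains $\lambda\mu+(1-\lambda)\nu$ for all $\mu,\nu\in H$ and $\lambda\in\mathbb{R}$. An extreme point of a convex set $\mathcal{C}$ of probability measures is a $p\in\mathcal{C}$ such that $p=\lambda p'+(1-\lambda)p''$ with $p',p''\in\mathcal{C}$ and $\lambda\in(0,1)$ implies $p'=p''=p$. *)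

(* Defs.v *)
From HB Require Import structures.
From mathcomp Require Import all_boot all_order all_algebra.
From mathcomp Require Import all_classical all_reals all_analysis.
Set Implicit Arguments.
Unset Strict Implicit.
Unset Printing Implicit Defensive.
Import Order.TTheory GRing.Theory Num.Theory.
Import numFieldNormedType.Exports.
Local Open Scope classical_set_scope.
Local Open Scope ring_scope.

(* Signed measures of finite variation are rendered as [{charge set T -> \bar R}]:
   a charge takes finite values on measurable sets, and a real-valued countably
   additive set function on a sigma-algebra always has finite total variation. *)

Section defs.
Context (d : measure_display) (T : measurableType d) (R : realType).
Implicit Types (mu nu rho : {charge set T -> \bar R}) (p q : probability T R).

(* Charges and measures are functions on all of [set T], with unconstrained
   values on non-measurable sets, so equality of signed measures is equality on
   the sigma-algebra rather than Leibniz equality. *)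
Definition charge_eq mu nu : Prop :=
  forall A : set T, measurable A -> mu A = nu A.

Definition affine_comb (l : R) mu nu : {charge set T -> \bar R} :=
  cadd (cscale l mu) (cscale (1 - l) nu).

(* The quantification over [rho] makes an affine set closed under [charge_eq]
   (take [l = 1]), i.e. a set of signed measures on the sigma-algebra. *)
Definition affine_set (H : set ({charge set T -> \bar R})) : Prop :=
  forall mu nu rho (l : R), H mu -> H nu ->
    charge_eq rho (affine_comb l mu nu) -> H rho.

Definition prob_charge p : {charge set T -> \bar R} :=
  charge_of_finite_measure p.

Definition extreme_point (C : set (probability T R)) p : Prop :=
  C p /\
  forall (p' p'' : probability T R) (l : R), C p' -> C p'' -> 0 < l < 1 ->
    charge_eq (prob_charge p)
      (affine_comb l (prob_charge p') (prob_charge p'')) ->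
    charge_eq (prob_charge p') (prob_charge p) /\
    charge_eq (prob_charge p'') (prob_charge p).

Definition equivalent_prob p q : Prop := p `<< q /\ q `<< p.

Definition dominated_probs q : set (probability T R) := [set p | p `<< q].

Definition probs_in (H : set ({charge set T -> \bar R})) :
  set (probability T R) := [set p | H (prob_charge p)].

End defs.

(* Main.v *)
Require Import Defs.
From HB Require Import structures.
From mathcomp Require Import all_boot all_order all_algebra.
From mathcomp Require Import all_classical all_reals all_analysis.
From mathcomp Require Import ring lra.
Import Order.TTheory GRing.Theory Num.Theory.
Local Open Scope classical_set_scope.
Local Open Scope ring_scope.

(** Mixing with [p] restores equivalence with [q]: if [p] is equivalent to [q]
    and [p'] is merely dominated by [q], the midpoint of [p] and [p'] is again
    equivalent to [q], since it is dominated by [q] like both endpoints and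
    charges whatever [p] charges ([equivalent_prob_midpoint]).

    So a splitting [p = l p' + (1 - l) p''] inside the larger set can be
    contracted towards [p]: the midpoints of [p] with [p'] and with [p'']
    average to [p] with the same weight [l] ([midpoint_splitting]), they are
    equivalent to [q], and they stay in [H] because [H] is affine
    ([affine_set_midpoint]).  Extremality of [p] among the measures equivalent
    to [q] makes both midpoints equal to [p], hence [p'] and [p''] equal [p]
    ([midpoint_fixed]). *)

Section midpoint.
Context (d : measure_display) (T : measurableType d) (R : realType).
Implicit Types p q : probability T R.

Lemma prob_chargeE p (A : set T) : prob_charge p A = p A.
Proof. by []. Qed.

Lemma affine_combE (l : R) (mu nu : {charge set T -> \bar R}) (A : set T) :
  affine_comb l mu nu A = (l%:E * mu A + (1 - l)%:E * nu A)%E.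
Proof. by []. Qed.

(** The bare set function of [midpoint], kept apart because its measure and
    probability structures are attached to it before it can be bundled. *)
Definition half_sum p q : set T -> \bar R :=
  mscale (2^-1)%:nng (measure_add p q).

Let half_sumE p q (A : set T) :
  half_sum p q A = ((2^-1)%:E * (p A + q A))%E.
Proof. by rewrite -measure_addE. Qed.

HB.instance Definition _ p q := Measure.on (half_sum p q).

Let half_sum_setT p q : half_sum p q setT = 1%E.
Proof.
rewrite half_sumE !probability_setT -EFinD -EFinM.
by congr EFin; field.
Qed.

HB.instance Definition _ p q :=
  Measure_isProbability.Build _ _ _ (half_sum p q) (half_sum_setT p q).

Definition midpoint p q : probability T R := half_sum p q.

Lemma midpointE p q (A : set T) :
  midpoint p q A = ((2^-1)%:E * (p A + q A))%E.
Proof. exact: half_sumE. Qed.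

Lemma null_dominates_midpoint p p' : p `<< midpoint p p'.
Proof.
apply/null_content_dominatesP => A mA /eqP.
rewrite [_ A]midpointE mule_eq0 eqe invr_eq0 pnatr_eq0/=.
by rewrite padde_eq0 ?measure_ge0// => /andP[/eqP].
Qed.

Lemma midpoint_null_dominates p p' q :
  p `<< q -> p' `<< q -> midpoint p p' `<< q.
Proof.
move=> /null_content_dominatesP pq /null_content_dominatesP p'q.
apply/null_content_dominatesP => A mA qA0.
by rewrite midpointE pq// p'q// adde0 mule0.
Qed.

Lemma equivalent_prob_midpoint p p' q :
  equivalent_prob p q -> p' `<< q -> equivalent_prob (midpoint p p') q.
Proof.
move=> [pq qp] p'q; split; first exact: midpoint_null_dominates.
by move=> A /null_dominates_midpoint /qp.
Qed.

Lemma affine_set_midpoint (H : set ({charge set T -> \bar R})) p p' :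
  affine_set H -> probs_in H p -> probs_in H p' ->
  probs_in H (midpoint p p').
Proof.
move=> affH Hp Hp'; apply: (affH _ _ _ 2^-1 Hp Hp') => A mA.
rewrite affine_combE !prob_chargeE midpointE.
rewrite -(fineK (fin_num_measure p A mA)) -(fineK (fin_num_measure p' A mA)).
by rewrite -!(EFinD, EFinM); congr EFin; field.
Qed.

(** The homothety of centre [p] and ratio [1/2] fixes [p] and preserves affine
    combinations. *)
Lemma midpoint_splitting p p' p'' (l : R) :
  charge_eq (prob_charge p) (affine_comb l (prob_charge p') (prob_charge p'')) ->
  charge_eq (prob_charge p)
    (affine_comb l (prob_charge (midpoint p p'))
                   (prob_charge (midpoint p p''))).
Proof.
move=> comb A mA; have := comb A mA.
rewrite !affine_combE !prob_chargeE !midpointE.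
rewrite -(fineK (fin_num_measure p A mA)) -(fineK (fin_num_measure p' A mA)).
rewrite -(fineK (fin_num_measure p'' A mA)).
rewrite -!(EFinD, EFinM) => -[pE]; congr EFin.
by lra.
Qed.

Lemma midpoint_fixed p p' :
  charge_eq (prob_charge (midpoint p p')) (prob_charge p) ->
  charge_eq (prob_charge p') (prob_charge p).
Proof.
move=> mid A mA; have := mid A mA.
rewrite !prob_chargeE midpointE.
rewrite -(fineK (fin_num_measure p A mA)) -(fineK (fin_num_measure p' A mA)).
by rewrite -!(EFinD, EFinM) => -[midE]; congr EFin; lra.
Qed.

End midpoint.
Arguments midpoint {d T R}.

Theorem proposition3p12 (d : measure_display) (T : measurableType d)
  (R : realType) (q : probability T R) (H : set ({charge set T -> \bar R}))
  (affH : affine_set H) :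
  let PqH := dominated_probs q `&` probs_in H in
  let M := [set p | PqH p /\ equivalent_prob p q] in
  forall p : probability T R, extreme_point M p -> extreme_point PqH p.
Proof.
move=> PqH M p [[[pq Hp] p_eqv_q] p_extreme]; split => //.
have M_midpoint r : PqH r -> M (midpoint p r).
  move=> [rq Hr]; split; last exact: equivalent_prob_midpoint.
  by split; [exact: midpoint_null_dominates|exact: affine_set_midpoint].
move=> p' p'' l Cp' Cp'' l01 /midpoint_splitting comb.
have [mid' mid''] :=
  p_extreme _ _ _ (M_midpoint _ Cp') (M_midpoint _ Cp'') l01 comb.
by split; exact: midpoint_fixed.
Qed.
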